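(* Let $H$ be a graph and let $G$ be a weighted graph with $k+1$ distinguished vertices $u_0,u_1,\dots,u_k$ such that $u_0u_1,\dots,u_0u_k$ are edges of $G$ and $\{u_1,\dots,u_k\}$ is an independent set. For $i=1,\dots,k$ let $U_i$ be a subset of the neighbours of $u_i$ with $u_0\in U_i$. Let $M$ be the $k\times k$ matrix whose entry $M_{ij}$ is the sum of the weights of all homomorphisms $f$ from $H$ to $G$ with $f(v_0)=u_0$, $f(v_1)=u_i$, $f(v_2)=u_j$, taken over all choices of vertices $v_0,v_1,v_2\in V(H)$ with $v_0v_1,v_0v_2\in E(H)$, and over all such $f$ for which $f$ restricted to the neighbourhood of $v_1$ is a bijection onto $U_i$ and $f$ restricted to the neighbourhood of $v_2$ is a bijection onto $U_j$. If $M$ is not positive semidefinite, then $H$ does not have the step Sidorenko property.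
   Context: All graphs are finite, simple and loopless. A weighted graph is a graph $G$ with a weight function $w$ assigning a non-negative real weight to every vertex and every edge. A homomorphism from $H$ to $G$ is a map $f:V(H)\to V(G)$ with $f(v)f(v')\in E(G)$ whenever $vv'\in E(H)$; its weight is $\prod_{v\in V(H)}w(f(v))\prod_{vv'\in E(H)}w(f(v)f(v'))$. A graphon is a measurable symmetric function $W:[0,1]^2\to[0,1]$, and $t(H,W)=\int_{[0,1]^{V(H)}}\prod_{vv'\in E(H)}W(x_v,x_{v'})\,dx$. For a partition $\mathcal P$ of $[0,1]$ into finitely many measurable sets of positive measure, $W^{\mathcal P}(x,y)=\frac{1}{|J||J'|}\int_{J\times J'}W(s,t)\,ds\,dt$, where $J,J'\in\mathcal P$ contain $x$ and $y$ respectively. A graph $H$ has the step Sidorenko property if $t(H,W^{\mathcal P})\le t(H,W)$ for every graphon $W$ and every such partition $\mathcal P$. *)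

(* Defs.v *)
From HB Require Import structures.
From mathcomp Require Import all_boot all_order all_algebra.
From mathcomp Require Import all_classical all_reals all_analysis.

Set Implicit Arguments.
Unset Strict Implicit.
Unset Printing Implicit Defensive.

Import Order.TTheory GRing.Theory Num.Theory.

Local Open Scope classical_set_scope.
Local Open Scope ring_scope.

Record sgraph := SGraph {
  vertex :> finType;
  adj : rel vertex;
  adj_sym : symmetric adj;
  adj_irrefl : irreflexive adj }.

Definition nbrs (G : sgraph) (v : G) : {set G} := [set x | adj v x].

(* Every edge occurs exactly once, oriented along the enumeration of the
   vertices; only symmetric functions are evaluated on these pairs. *)
Definition edges (G : sgraph) : {set G * G} :=
  [set e | adj e.1 e.2 && (enum_rank e.1 < enum_rank e.2)%N].

Record wgraph (R : realType) := WGraph {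
  wg_graph :> sgraph;
  vweight : wg_graph -> R;
  eweight : wg_graph -> wg_graph -> R;
  vweight_ge0 : forall x, 0 <= vweight x;
  eweight_ge0 : forall x y, adj x y -> 0 <= eweight x y;
  eweight_sym : forall x y, adj x y -> eweight x y = eweight y x }.

Definition is_hom (H G : sgraph) (f : {ffun H -> G}) : bool :=
  [forall v, forall v', adj v v' ==> adj (f v) (f v')].

Definition hom_weight (R : realType) (H : sgraph) (G : wgraph R)
    (f : {ffun H -> G}) : R :=
  (\prod_(v : H) vweight (f v)) *
  (\prod_(e in edges H) eweight (f e.1) (f e.2)).

Definition bij_onto (aT rT : finType) (f : aT -> rT)
    (A : {set aT}) (B : {set rT}) : bool :=
  dinjectiveb f (mem A) && (f @: A == B)%SET.

(* v1 = v2 is allowed in the sum. *)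
Definition walk_mx (R : realType) (H : sgraph) (G : wgraph R) (k : nat)
    (u0 : G) (u : 'I_k -> G) (U : 'I_k -> {set G}) : 'M[R]_k :=
  \matrix_(i, j)
    \sum_(v0 : H) \sum_(v1 : H | adj v0 v1) \sum_(v2 : H | adj v0 v2)
      \sum_(f : {ffun H -> G} |
              [&& is_hom f, f v0 == u0, f v1 == u i, f v2 == u j,
                  bij_onto f (nbrs v1) (U i) & bij_onto f (nbrs v2) (U j)])
        hom_weight f.

Definition psdmx (R : realType) (k : nat) (A : 'M[R]_k) : Prop :=
  A^T = A /\ forall x : 'cV[R]_k, 0 <= (x^T *m A *m x) 0 0.

(* Functions on [0,1]^2 are represented by functions on R^2, of which only
   the values on [0,1]^2 matter. *)
Record graphon (R : realType) (W : R -> R -> R) : Prop := Graphon {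
  graphon_meas : measurable_fun (`[0, 1] `*` `[0, 1] : set (R * R))
                   (fun p : R * R => W p.1 p.2);
  graphon_sym : forall x y, x \in `[0, 1] -> y \in `[0, 1] -> W x y = W y x;
  graphon_rng : forall x y, x \in `[0, 1] -> y \in `[0, 1] ->
                  W x y \in `[0, 1] }.

(* Integral of F over the coordinates listed in s, each ranging over [0,1],
   the other coordinates being those of x. *)
Fixpoint iter_integral (R : realType) (V : eqType) (s : seq V)
    (F : (V -> R) -> \bar R) (x : V -> R) : \bar R :=
  if s is v :: s' then
    (\int[@lebesgue_measure R]_(a in `[0%R, 1%R])
      iter_integral s' F [eta x with v |-> a])%E
  else F x.

(* The integral over the cube [0,1]^V(H) is an iterated integral, which for the
   nonnegative measurable integrands used here agrees with the integral against
   the product measure; the initial point 0 is overwritten in every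
   coordinate. *)
Definition hom_density (R : realType) (H : sgraph) (W : R -> R -> R) : \bar R :=
  iter_integral (enum H)
    (fun x : H -> R => (\prod_(e in edges H) W (x e.1) (x e.2))%:E)
    (fun _ => 0).

Record unit_partition (R : realType) (n : nat) (P : 'I_n -> set R) : Prop :=
  UnitPartition {
  part_meas : forall i, measurable (P i);
  part_gt0 : forall i, (0 < @lebesgue_measure R (P i))%E;
  part_disj : trivIset setT P;
  part_cover : \bigcup_i P i = `[0, 1]%classic }.

Definition block_avg (R : realType) (W : R -> R -> R) (J J' : set R) : R :=
  fine (\int[@lebesgue_measure R \x @lebesgue_measure R]_(p in J `*` J')
          (W p.1 p.2)%:E)%E
  / (fine (@lebesgue_measure R J) * fine (@lebesgue_measure R J')).

Definition step_graphon (R : realType) (n : nat) (P : 'I_n -> set R)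
    (W : R -> R -> R) (x y : R) : R :=
  \sum_(i < n) \sum_(j < n) \1_(P i) x * \1_(P j) y * block_avg W (P i) (P j).

Definition step_sidorenko (R : realType) (H : sgraph) : Prop :=
  forall (W : R -> R -> R) (n : nat) (P : 'I_n -> set R),
    graphon W -> unit_partition P ->
    (hom_density H (step_graphon P W) <= hom_density H W)%E.

(* Main.v *)
(** Every vertex y of G gets, besides the original, one twin y_s for each
    s : V(G) -> {1, ..., B}; the twin has a small weight eta and its edges
    towards copies of y' are multiplied by s(y').  If v in V(H) is mapped to a
    copy of y and the neighbours of v to copies of prescribed vertices, then
    summing over the choice of the twin gives a combination of values of a
    monomial of degree at most #|H|.  As B exceeds that degree, some coefficients
    q(s) extract from these values exactly the indicator that the neighbours
    of v are mapped bijectively onto U_i (Vandermonde).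

    Now split every vertex into two halves of sign +1 and -1, and multiply the
    edge from u_0 with sign sigma to the twin (u_i)_s by
    1 + eps sigma x_i q(s) w(u_i) / eta.  Averaging over the signs removes the
    perturbation.  In the difference of the two homomorphism sums the terms of
    order 0 and 1 in eps vanish, and the coefficient of eps^2 is, up to a
    positive factor, a polynomial in eta whose value at 0 is x^T M x minus the
    terms v_1 = v_2, which are nonnegative.  If x^T M x < 0, it is thus
    negative for small eta, and then so is the difference for small eps.  The
    weighted graphs become graphons by cutting [0, 1] into intervals. *)
Require Import Defs.
From mathcomp Require Import all_boot all_order all_algebra.
From mathcomp Require Import all_classical all_reals all_analysis.
From mathcomp Require Import measurable_realfun ring lra.

Set Implicit Arguments.
Unset Strict Implicit.
Unset Printing Implicit Defensive.

Import Order.TTheory GRing.Theory Num.Theory.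

Local Open Scope classical_set_scope.
Local Open Scope ring_scope.

(** * Step functions on the unit interval *)

(** The classes are consecutive left-open intervals whose end points are the partial sums [p] of
    [m]. *)
Lemma exists_class_map (R : realType) (T : finType) (m : T -> R) :
  (forall t, 0 <= m t) -> \sum_t m t = 1 ->
  exists c : R -> T, forall t,
    measurable (`[0, 1] `&` c @^-1` [set t]) /\
    @lebesgue_measure R (`[0, 1] `&` c @^-1` [set t]) = (m t)%:E.
Proof.
move=> m0 m1.
have [t0 _|T0] := pickP (@predT T); last first.
  by move: m1; rewrite big_pred0 // => /eqP; rewrite eq_sym oner_eq0.
pose p i := \sum_(t | (enum_rank t < i)%N) m t.
have pS (t : T) : p (enum_rank t).+1 = p (enum_rank t) + m t.
  rewrite /p (bigD1 t) //= addrC; congr (_ + _); apply: eq_bigl => s.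
  rewrite ltnS ltn_neqAle andbC; congr (_ && _).
  by rewrite (inj_eq val_inj) (inj_eq enum_rank_inj).
have ple i j : (i <= j)%N -> p i <= p j.
  move=> ij; rewrite /p [leRHS](bigID (fun t => (enum_rank t < i)%N)) /=.
  rewrite -[leLHS]addr0; apply: lerD; last exact: sumr_ge0.
  rewrite [leRHS](eq_bigl (fun s => (enum_rank s < i)%N)) // => s.
  by apply/andP/idP => [[]//|si]; rewrite si (leq_trans si ij).
have p0 : p 0%N = 0 by rewrite /p big_pred0.
have p1 : p #|T| = 1 by rewrite -m1; apply: eq_bigl => t; exact: ltn_ord.
have pge0 i : 0 <= p i by rewrite -p0 ple.
have ple1 (t : T) : p (enum_rank t).+1 <= 1.
  by rewrite -p1; exact: (ple _ _ (ltn_ord (enum_rank t))).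
pose inI (x : R) (t : T) := p (enum_rank t) < x <= p (enum_rank t).+1.
have inI_uniq x s t : inI x s -> inI x t -> s = t.
  move=> /andP[s1 s2] /andP[t1 t2]; apply/enum_rank_inj/ord_inj/eqP.
  case: ltngtP => // /ple.
    by move=> /(le_trans s2); rewrite leNgt t1.
  by move=> /(le_trans t2); rewrite leNgt s1.
have inI_ex x : 0 < x <= 1 -> exists t, inI x t.
  move=> /andP[x0 x1].
  (* The interval holding [x] ends at the least [i] with [x <= p i]. As [x > 0], this [i] is a
     successor, and its predecessor is the rank sought. *)
  have ex : exists i, x <= p i by exists #|T|; rewrite p1.
  case: (ex_minnP ex) => -[|i] xi mini.
    by move: xi; rewrite p0 leNgt x0.
  have iT : (i < #|T|)%N by apply: mini; rewrite p1.
  exists (enum_val (Ordinal iT)); rewrite /inI enum_valK /= xi andbT ltNge.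
  by apply/negP => /mini; rewrite ltnn.
(* Within [0, 1] the default [t0] is taken only at 0, which lies in no interval; the class of [t0]
   thereby gains a null set. *)
exists (fun x => odflt t0 [pick t | inI x t]) => t.
have -> : `[0, 1] `&` (fun x => odflt t0 [pick t | inI x t]) @^-1` [set t] =
    `]p (enum_rank t), p (enum_rank t).+1] `|`
    (if t == t0 then [set 0] else set0).
  apply/seteqP; split => x /=.
    rewrite in_itv /= => -[/andP[]]; rewrite le_eqVlt => /predU1P[<-{x} _|x0 x1].
      case: pickP => [s /andP[+ _]|_ /= <-]; first by rewrite ltNge pge0.
      by right; rewrite eqxx.
    have /inI_ex[s xs] : 0 < x <= 1 by rewrite x0.
    case: pickP => [s' xs' /= <-|/(_ s)]; last by rewrite xs.
    by left; rewrite in_itv.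
  rewrite !in_itv /= => -[xt|].
    split.
      by case/andP: xt => a b; rewrite (ltW (le_lt_trans (pge0 _) a)) (le_trans b).
    case: pickP => [s xs /=|/(_ t)]; last by rewrite /inI xt.
    exact: inI_uniq xs xt.
  case: eqP => [->|//] ->; rewrite lexx ler01; split => //.
  by case: pickP => [s /andP[+ _]|//]; rewrite ltNge pge0.
have mZ : measurable (if t == t0 then [set 0 : R] else set0).
  by case: ifP => _; [exact: measurable_set1 | exact: measurable0].
split; first by apply: measurableU => //; exact: measurable_itv.
rewrite measureU0; [|exact: measurable_itv|exact: mZ|]; last first.
  by case: ifP => _; [exact: lebesgue_measure_set1 | exact: measure0].
apply: (etrans (lebesgue_measure_itv _)); rewrite /= lte_fin pS ltrDl -EFinB addrC addKr.
by case: ltP => // mt; congr (_%:E); apply/eqP; rewrite eq_le m0.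
Qed.

(** * Integrals of functions of the class *)

Section ClassMap.
Context (R : realType) (T : finType) (m : T -> R) (c : R -> T).
Local Notation mu := (@lebesgue_measure R).
Local Notation Q t := (`[0, 1] `&` c @^-1` [set t]).
Hypothesis cP : forall t, measurable (Q t) /\ mu (Q t) = (m t)%:E.

Let mQ t : measurable (Q t). Proof. by case: (cP t). Qed.
Let muQ t : mu (Q t) = (m t)%:E. Proof. by case: (cP t). Qed.

Let m_ge0 t : 0 <= m t.
Proof. by rewrite -lee_fin -muQ; exact: measure_ge0. Qed.

Let indicQ t (x : R) : x \in `[0, 1] -> \1_(Q t) x = (c x == t)%:R :> R.
Proof.
move=> x01; rewrite indicE; congr (_ %:R); congr nat_of_bool.
by apply/idP/eqP => [|<-]; [rewrite inE => -[] | rewrite inE].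
Qed.

Lemma integral_class (h : T -> R) : (forall t, 0 <= h t) ->
  (\int[mu]_(x in `[0%R, 1%R]) (h (c x))%:E = (\sum_t m t * h t)%:E)%E.
Proof.
move=> h0.
transitivity (\int[mu]_(x in `[0%R, 1%R])
  \sum_t ((h t)%:E * (\1_(`[0%R, 1%R] `&` c @^-1` [set t]) x)%:E))%E.
  apply: eq_integral => x; rewrite inE /= => x01.
  under eq_bigr do rewrite indicQ // -EFinM.
  rewrite sumEFin (bigD1 (c x)) //= eqxx mulr1 big1 ?addr0 // => t.
  by rewrite eq_sym => /negPf ->; rewrite mulr0.
rewrite ge0_integral_sum //; first last.
- by move=> t x _; rewrite mule_ge0 ?lee_fin.
- move=> t; apply/measurable_EFinP; apply: measurable_funM => //.
  apply: measurable_indic; exact: mQ.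
rewrite -sumEFin; apply: eq_bigr => t _.
rewrite ge0_integralZl_EFin //; first last.
  by apply/measurable_EFinP; apply: measurable_indic; exact: mQ.
rewrite integral_indic; [|exact: measurable_itv|exact: mQ].
by rewrite setIAC setIid [X in (_ * X)%E]muQ -EFinM mulrC.
Qed.

(** Induction on [s]: each integration turns one coordinate into a sum over its class, weighted by
    [m]. Coordinates outside [s] stay frozen at the class of [x], whence the constraint on [f]. *)
Lemma iter_integral_class (V : finType) (s : seq V) (F : (V -> R) -> \bar R)
    (g : {ffun V -> T} -> R) (x : V -> R) : uniq s ->
    (forall f, 0 <= g f) ->
    (forall y, (forall v, y v \in `[0, 1]) -> F y = (g [ffun v => c (y v)])%:E) ->
    (forall v, x v \in `[0, 1]) ->
  iter_integral s F x =
  (\sum_(f : {ffun V -> T} | [forall v, (v \in s) || (f v == c (x v))])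
     (\prod_(v <- s) m (f v)) * g f)%:E.
Proof.
move=> + g0 FE; elim: s x => [|v s IH] x /=.
  move=> _ x01; rewrite FE // (big_pred1 [ffun v => c (x v)]).
    by rewrite big_nil mul1r.
  move=> f; apply/forallP/eqP => [fx|-> v]; last by rewrite ffunE.
  by apply/ffunP => v; rewrite ffunE; apply/eqP/fx.
move=> /andP[vs us] x01.
(* The inner integral depends on the value at [v] only through its class; [h] is this dependence. *)
pose h t := \sum_(f : {ffun V -> T} |
    [forall w, (w \in s) || (f w == if w == v then t else c (x w))])
  (\prod_(w <- s) m (f w)) * g f.
rewrite (@eq_integral _ _ _ mu _ (fun a => (h (c a))%:E)); last first.
  move=> a; rewrite inE /= => a01; rewrite IH //.
    congr (_ %:E); apply: eq_bigl => f; apply: eq_forallb => w /=.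
    by case: (w == v).
  by move=> w /=; case: (w == v).
rewrite integral_class; last first.
  by move=> t; apply: sumr_ge0 => f _; rewrite mulr_ge0 // prodr_ge0.
congr (_ %:E); rewrite [RHS](partition_big (fun f : {ffun V -> T} => f v) predT) //=.
apply: eq_bigr => t _; rewrite big_distrr /=; apply: eq_big => [f|f].
  apply/forallP/andP => [fP|[/forallP fP /eqP ft] w].
    split; last by have := fP v; rewrite (negPf vs) eqxx.
    by apply/forallP => w; have := fP w; rewrite inE; case: (w == v).
  have := fP w; rewrite inE; case: eqP => // -> _.
  by rewrite ft eqxx orbT.
move=> /forallP/(_ v); rewrite (negPf vs) eqxx /= => /eqP <-.
by rewrite big_cons mulrA.
Qed.

Lemma hom_density_class (H : sgraph) (W : R -> R -> R) (K : T -> T -> R) :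
    (forall s t, 0 <= K s t) ->
    (forall x y, x \in `[0, 1] -> y \in `[0, 1] -> W x y = K (c x) (c y)) ->
  hom_density H W =
  (\sum_(f : {ffun H -> T}) (\prod_v m (f v)) *
     \prod_(e in edges H) K (f e.1) (f e.2))%:E.
Proof.
move=> K0 WK; rewrite /hom_density.
rewrite (@iter_integral_class _ _ _
  (fun f : {ffun H -> T} => \prod_(e in edges H) K (f e.1) (f e.2))).
- congr (_ %:E); apply: eq_big => [f|f _].
    by apply/forallP => v; rewrite mem_enum.
  by rewrite big_enum.
- exact: enum_uniq.
- by move=> f; apply: prodr_ge0.
- move=> y y01; congr (_ %:E); apply: eq_bigr => e _.
  by rewrite WK // !ffunE.
- by move=> v; rewrite in_itv /= lexx ler01.
Qed.

Lemma measurable_class (A : {pred T}) :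
  measurable (`[0, 1] `&` [set x | c x \in A]).
Proof.
rewrite (_ : _ `&` _ = \bigcup_(t in [set` A]) Q t).
  by rewrite bigcup_pred; apply: bigsetU_measurable => t _; exact: mQ.
apply/seteqP; split=> x /= [].
  by move=> x01 cxA; exists (c x).
by move=> t /= tA [x01 xt]; split => //; rewrite xt.
Qed.

Lemma measure_class (A : {pred T}) :
  mu (`[0, 1] `&` [set x | c x \in A]) = (\sum_(t in A) m t)%:E.
Proof.
rewrite -{1}(setIid `[0, 1]%classic) setIAC -integral_indic;
  [|exact: measurable_itv|exact: measurable_class].
rewrite (@eq_integral _ _ _ mu _ (fun x => ((c x \in A)%:R)%:E)); last first.
  move=> x; rewrite inE /= => x01; rewrite indicE; congr ((_ %:R) %:E).
  by congr nat_of_bool; apply/idP/idP; rewrite inE /= => //; case.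
rewrite (integral_class (h := fun t => (t \in A)%:R)) //.
congr (_ %:E); rewrite [RHS]big_mkcond; apply: eq_bigr => t _.
by case: ifP; rewrite ?mulr1 ?mulr0.
Qed.

Lemma integral_class2 (A B : {pred T}) (K : T -> T -> R) :
  (forall s t, 0 <= K s t) ->
  (\int[mu \x mu]_(p in (`[0%R, 1%R] `&` [set x | c x \in A]) `*`
                        (`[0%R, 1%R] `&` [set x | c x \in B]))
     (K (c p.1) (c p.2))%:E)%E =
  (\sum_(s in A) \sum_(t in B) m s * m t * K s t)%:E.
Proof.
move=> K0; set D := _ `*` _.
have mD : measurable D by apply: measurableX; exact: measurable_class.
have mQQ s t : measurable (Q s `*` Q t) by apply: measurableX; exact: mQ.
transitivity (\int[mu \x mu]_(p in D) \sum_(q : T * T)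
    ((K q.1 q.2)%:E * (\1_(Q q.1 `*` Q q.2) p)%:E))%E.
  apply: eq_integral => p; rewrite inE /= => -[[p1 _] [p2 _]].
  rewrite (bigD1 (c p.1, c p.2)) //= big1 ?adde0; last first.
    move=> [s t] /= st; rewrite indicE memNset ?mule0 //= => -[[_ ps] [_ pt]].
    by move: st; rewrite -ps -pt eqxx.
  by rewrite indicE mem_set ?mule1.
rewrite ge0_integral_sum //; first last.
- by move=> t x _; apply: mule_ge0; rewrite lee_fin.
- move=> t; apply/measurable_EFinP; apply: measurable_funM => //.
  by apply: measurable_indic; exact: mQQ.
rewrite pair_big_dep -sumEFin [RHS]big_mkcond /=; apply: eq_bigr => -[s t] _ /=.
rewrite ge0_integralZl_EFin //; first last.
  by apply/measurable_EFinP; apply: measurable_indic; exact: mQQ.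
rewrite integral_indic; [|exact: mD|exact: mQQ].
rewrite /=; case: ifP => [/andP[sA tB]|stAB].
  rewrite setIidl; last first.
    by move=> p /= [[p1 ps] [p2 pt]]; split; split => //=; rewrite ?ps ?pt.
  rewrite [X in (_ * X)%E]product_measure1E; [|exact: mQ|exact: mQ].
  by rewrite -[m s * m t * _]mulrC !EFinM -!muQ.
rewrite (_ : _ `&` _ = set0) ?measure0 ?mule0 //.
apply/seteqP; split => // p /= [[[_ ps] [_ pt]] [[_ sA] [_ tB]]].
by move: stAB; rewrite -ps -pt sA tB.
Qed.

Lemma measurable_class2 (K : T -> T -> R) :
  measurable_fun (`[0, 1] `*` `[0, 1] : set (R * R))
    (fun p : R * R => K (c p.1) (c p.2)).
Proof.
have mQQ s t : measurable (Q s `*` Q t) by apply: measurableX; exact: mQ.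
apply: (eq_measurable_fun (fun p : R * R => \sum_(q : T * T)
    (K q.1 q.2 * \1_(Q q.1 `*` Q q.2) p))).
  move=> p; rewrite inE /= => -[p1 p2].
  rewrite (bigD1 (c p.1, c p.2)) //= big1 ?addr0; last first.
    move=> [s t] /= st; rewrite indicE memNset ?mulr0 //= => -[[_ ps] [_ pt]].
    by move: st; rewrite -ps -pt eqxx.
  by rewrite indicE mem_set ?mulr1.
apply: measurable_sum => q; exact: measurable_funM.
Qed.

End ClassMap.

(** * The step Sidorenko inequality for weighted kernels *)

Lemma sum_prod_scale (R : realType) (H : sgraph) (T : finType) (m : T -> R)
    (K : T -> T -> R) (a b : R) :
  \sum_(f : {ffun H -> T}) (\prod_v (a * m (f v))) *
    \prod_(e in edges H) (b * K (f e.1) (f e.2)) =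
  a ^+ #|H| * b ^+ #|edges H| *
  \sum_(f : {ffun H -> T}) (\prod_v m (f v)) *
    \prod_(e in edges H) K (f e.1) (f e.2).
Proof.
rewrite big_distrr /=; apply: eq_bigr => f _.
by rewrite !big_split /= !prodr_const mulrACA.
Qed.

(* T lists the steps of a step graphon and pi : T -> S merges them into the parts
   of a partition; K' is the average of K over these parts. *)
Lemma step_sidorenko_weighted (R : realType) (H : sgraph) (T S : finType)
    (pi : T -> S) (t0 : T) (m : T -> R) (K K' : T -> T -> R) :
  step_sidorenko R H ->
  (forall t, 0 < m t) -> (forall s, exists t, pi t = s) ->
  (forall s t, 0 <= K s t) -> (forall s t, K s t = K t s) ->
  (forall s t, \sum_(a | pi a == pi s) \sum_(b | pi b == pi t) m a * m b * K a b =
     K' s t * ((\sum_(a | pi a == pi s) m a) * \sum_(b | pi b == pi t) m b)) ->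
  \sum_(f : {ffun H -> T}) (\prod_v m (f v)) *
     \prod_(e in edges H) K' (f e.1) (f e.2) <=
  \sum_(f : {ffun H -> T}) (\prod_v m (f v)) *
     \prod_(e in edges H) K (f e.1) (f e.2).
Proof.
move=> sid m_gt0 pi_surj K_ge0 K_sym K'E.
pose M s := \sum_(a | pi a == s) m a.
have M_gt0 s : 0 < M s.
  have [t <-] := pi_surj s; rewrite /M (bigD1 t) //= ltr_pwDl //.
  by apply: sumr_ge0 => a _; exact: ltW.
have K'_ge0 s t : 0 <= K' s t.
  rewrite -(pmulr_lge0 _ (mulr_gt0 (M_gt0 (pi s)) (M_gt0 (pi t)))) -K'E.
  by apply: sumr_ge0 => a _; apply: sumr_ge0 => b _; rewrite !mulr_ge0 // ltW.
pose Z := \sum_t m t.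
have Z_gt0 : 0 < Z.
  by rewrite /Z (bigD1 t0) //= ltr_pwDl // sumr_ge0 // => a _; exact: ltW.
(* Dividing by [C] brings [K] into [0, 1]; the summand 1 keeps [C] positive even if [K] vanishes. *)
pose C := 1 + \sum_s \sum_t K s t.
have sK_ge0 s : 0 <= \sum_t K s t by apply: sumr_ge0.
have C_gt0 : 0 < C by rewrite ltr_pwDl // sumr_ge0.
have KC s t : K s t <= C.
  have st : K s t <= \sum_t K s t by rewrite (bigD1 t) //= lerDl sumr_ge0.
  apply: (le_trans st); apply: (@le_trans _ _ (\sum_s \sum_t K s t)).
    by rewrite [leRHS](bigD1 s) //= lerDl sumr_ge0.
  by rewrite /C lerDr.
have [||c cP] := @exists_class_map R T (fun t => Z^-1 * m t).
- by move=> t; rewrite mulr_ge0 // ?invr_ge0 ltW.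
- by rewrite -big_distrr /= mulVf // gt_eqF.
pose W x y := C^-1 * K (c x) (c y).
pose A (i : 'I_#|S|) : {pred T} := [pred t | pi t == enum_val i].
pose P i : set R := `[0, 1] `&` [set x | c x \in A i].
have muP i : @lebesgue_measure R (P i) = (Z^-1 * M (enum_val i))%:E.
  by rewrite (measure_class cP) -big_distrr.
have WG : graphon W.
  split.
  - exact: (measurable_class2 cP (fun s t => C^-1 * K s t)).
  - by move=> x y _ _; rewrite /W K_sym.
  - move=> x y _ _; rewrite in_itv /= mulr_ge0 ?invr_ge0 ?(ltW C_gt0) //=.
    by rewrite /W mulrC ler_pdivrMr // mul1r.
have PU : unit_partition P.
  split.
  - by move=> i; exact: (measurable_class cP).
  - by move=> i; rewrite muP lte_fin mulr_gt0 // invr_gt0.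
  - move=> i j _ _ [x [[_ /eqP xi] [_ /eqP xj]]].
    by apply: enum_val_inj; rewrite -xi -xj.
  - apply/seteqP; split => [x [i _ []//]|x x01].
    exists (enum_rank (pi (c x))) => //; split => //=.
    by rewrite inE enum_rankK.
have avgE x y : block_avg W (P (enum_rank (pi (c x)))) (P (enum_rank (pi (c y)))) =
    C^-1 * K' (c x) (c y).
  rewrite /block_avg (integral_class2 cP _ _ (K := fun s t => C^-1 * K s t)) => [|s t]; last first.
    by rewrite mulr_ge0 // invr_ge0 ltW.
  rewrite !muP /= !enum_rankK.
  rewrite (eq_bigr (fun s => Z^-1 * Z^-1 * C^-1 *
     \sum_(t in A (enum_rank (pi (c y)))) m s * m t * K s t)); last first.
    move=> s _; rewrite big_distrr /=; apply: eq_bigr => t _.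
    by ring.
  rewrite -big_distrr /=.
  rewrite (eq_bigl (fun a => pi a == pi (c x))); last first.
    by move=> a; rewrite inE enum_rankK.
  under eq_bigr => s _.
    rewrite (eq_bigl (fun a => pi a == pi (c y))); last first.
      by move=> a; rewrite inE enum_rankK.
    over.
  rewrite K'E -/(M _) -/(M _).
  by field; rewrite !gt_eqF.
have stepE x y : x \in `[0, 1] -> y \in `[0, 1] ->
    step_graphon P W x y = C^-1 * K' (c x) (c y).
  move=> x01 y01; rewrite -avgE /step_graphon.
  have indP i z : z \in `[0, 1] ->
      \1_(P i) z = (i == enum_rank (pi (c z)))%:R :> R.
    move=> z01; rewrite indicE; congr (_ %:R); congr nat_of_bool.
    apply/idP/eqP => [/set_mem[_ /eqP ->]|->]; first by rewrite enum_valK.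
    by apply/mem_set; split => //=; rewrite inE enum_rankK.
  rewrite (bigD1 (enum_rank (pi (c x)))) //= (bigD1 (enum_rank (pi (c y)))) //=.
  rewrite !indP // !eqxx !mul1r !big1 ?addr0 //.
    move=> i /negPf ix; rewrite big1 // => j _.
    by rewrite indP // ix !mul0r.
  by move=> j /negPf jy; rewrite (indP j) // jy mulr0 mul0r.
have := sid W _ P WG PU.
rewrite (hom_density_class cP _ _ (K := fun s t => C^-1 * K' s t)) //; last first.
  by move=> s t; rewrite mulr_ge0 // invr_ge0 ltW.
rewrite (hom_density_class cP _ _ (K := fun s t => C^-1 * K s t)) //; last first.
  by move=> s t; rewrite mulr_ge0 // invr_ge0 ltW.
(* Normalising masses by [Z] and kernels by [C] multiplies both sides by the same positive factor,
   which cancels. *)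
by rewrite lee_fin !sum_prod_scale ler_pM2l // mulr_gt0 // exprn_gt0 ?invr_gt0.
Qed.

(** * Finite sums and coefficient extraction *)

Lemma sum_ffun_pair (R : nmodType) (V A B : finType)
    (F : {ffun V -> A * B} -> R) :
  \sum_f F f =
  \sum_(g : {ffun V -> A}) \sum_(h : {ffun V -> B}) F [ffun v => (g v, h v)].
Proof.
rewrite pair_bigA /=.
rewrite (reindex (fun p : {ffun V -> A} * {ffun V -> B} =>
  [ffun v => (p.1 v, p.2 v)])) //=.
exists (fun f : {ffun V -> A * B} => ([ffun v => (f v).1], [ffun v => (f v).2])).
  by move=> [g h] _ /=; congr (_, _); apply/ffunP => v; rewrite !ffunE.
by move=> f _; apply/ffunP => v; rewrite !ffunE -surjective_pairing.
Qed.

(** Every edge is listed in one orientation only, so combining both values of [F] runs over all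
    ordered adjacent pairs; absence of loops rules out equal ranks. *)
Lemma big_edges (R : Type) (idx : R) (op : Monoid.com_law idx) (H : sgraph)
    (F : H -> H -> R) :
  \big[op/idx]_(e in edges H) op (F e.1 e.2) (F e.2 e.1) =
  \big[op/idx]_v \big[op/idx]_(v' | adj v v') F v v'.
Proof.
rewrite big_split /= pair_big_dep /=.
rewrite [RHS](bigID (fun p : H * H => (enum_rank p.1 < enum_rank p.2)%N)) /=.
congr (op _ _); first by apply: eq_bigl => e; rewrite inE.
have swK : involutive (fun p : H * H => (p.2, p.1)) by case.
rewrite [RHS](reindex_inj (inv_inj swK)) /=.
apply: eq_bigl => e; rewrite inE [in RHS]adj_sym; case: (boolP (adj _ _)) => //= ee.
rewrite -leqNgt ltn_neqAle; case: eqP => //= eqr.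
by move: ee; rewrite (enum_rank_inj (ord_inj eqr)) adj_irrefl.
Qed.

(** The coefficients are elementary symmetric functions; the second is given through Newton's
    identity, which avoids sums over pairs of indices. *)
Lemma coef_prod_1DX (R : comNzRingType) (I : eqType) (r : seq I) (P : pred I)
    (c : I -> R) (p := \prod_(i <- r | P i) (1 + (c i)%:P * 'X)) :
  [/\ p`_0 = 1, p`_1 = \sum_(i <- r | P i) c i &
      p`_2 *+ 2 = (\sum_(i <- r | P i) c i) ^+ 2 - \sum_(i <- r | P i) c i ^+ 2].
Proof.
rewrite {}/p; elim: r => [|i r [p0 p1 p2]].
  by rewrite !big_nil !coef1 /= expr0n subrr mul0rn.
rewrite !big_cons; case: ifP => // _.
rewrite !mulrDl !mul1r -!mulrA !coefD !coefCM !coefXM /= p0 p1 mulr0 addr0 mulr1.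
split=> //; first by rewrite addrC.
by rewrite mulrnDl p2; ring.
Qed.

(** The nodes 1, ..., n are distinct, so their Vandermonde matrix is invertible, and [q] solves the
    resulting linear system. *)
Lemma coef_extraction (R : realFieldType) (n : nat) (e : 'I_n) :
  exists q : 'I_n -> R, forall k : 'I_n,
    \sum_j q j * j.+1%:R ^+ k = (k == e)%:R.
Proof.
pose V := @Vandermonde R n n (\row_j j.+1%:R).
have Vunit : V \in unitmx.
  rewrite unitmxE det_Vandermonde unitfE; apply/prodf_neq0 => i _.
  apply/prodf_neq0 => j ij; rewrite !mxE subr_eq0 eqr_nat eqSS.
  by rewrite neq_ltn ij orbT.
exists (fun j => (invmx V *m \col_k (k == e)%:R) j 0) => k.
have /matrixP/(_ k 0) := mulKVmx Vunit (\col_k (k == e)%:R : 'cV[R]_n).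
rewrite mxE [RHS]mxE => <-; apply: eq_bigr => j _.
by rewrite mulrC !mxE.
Qed.

(** The product of one-variable solutions works, since the sum over [s] factorises over [y]. *)
Lemma multi_coef_extraction (R : realFieldType) (n : nat) (Y : finType)
    (e : {ffun Y -> 'I_n}) :
  exists q : {ffun Y -> 'I_n} -> R, forall k : Y -> 'I_n,
    \sum_s q s * \prod_y (s y).+1%:R ^+ k y = [forall y, k y == e y]%:R.
Proof.
have [q qE] := choice (fun y => @coef_extraction R n (e y)).
exists (fun s => \prod_y q y (s y)) => k.
under eq_bigr do rewrite -big_split /=.
rewrite -(bigA_distr_bigA (fun y j => q y j * j.+1%:R ^+ k y)) /=.
under eq_bigr do rewrite qE.
case: (boolP [forall y, k y == e y]) => [/forallP ke|].
  by rewrite big1 // => y _; rewrite ke.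
by rewrite negb_forall => /existsP[y /negPf ky]; rewrite (bigD1 y) //= ky mul0r.
Qed.

(** Turns bijectivity into a condition on fibre sizes, which are the exponents of the monomial from
    which it will be extracted. *)
Lemma bij_onto_card (H Y : finType) (f : H -> Y) (A : {set H}) (U : {set Y}) :
  [forall y, #|[set v in A | f v == y]| == (y \in U)] = bij_onto f A U.
Proof.
apply/forallP/andP => [cardU|[/dinjectiveP finj /eqP fU] y].
  have fAU v : v \in A -> f v \in U.
    move=> vA; have := cardU (f v); case: (f v \in U) => //.
    by rewrite cards_eq0 => /eqP/setP/(_ v); rewrite !inE vA eqxx.
  split.
    apply/dinjectiveP => v w vA wA vw.
    have /cards1P[z Ez] : #|[set v' in A | f v' == f v]| == 1%N.
      by have := cardU (f v); rewrite fAU.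
    have : v \in [set z]%SET by rewrite -Ez inE vA eqxx.
    have : w \in [set z]%SET by rewrite -Ez inE wA vw eqxx.
    by rewrite !inE => /eqP -> /eqP ->.
  rewrite finset.eqEsubset; apply/andP; split.
    by apply/fintype.subsetP => _ /imsetP[v vA ->]; exact: fAU.
  apply/fintype.subsetP => y yU; have := cardU y; rewrite yU => /cards1P[v Ev].
  have : v \in [set v in A | f v == y]%SET by rewrite Ev inE.
  by rewrite inE => /andP[vA /eqP <-]; rewrite imset_f.
rewrite -fU; case: (boolP (y \in _)) => [/imsetP[v vA ->]|yA].
  apply/cards1P; exists v; apply/setP => w; rewrite !inE.
  by apply/andP/eqP => [[wA /eqP]|->]; [exact: finj | rewrite vA].
rewrite cards_eq0; apply/eqP/setP => v; rewrite !inE; apply/negbTE.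
by apply: contra yA => /andP[vA /eqP <-]; rewrite imset_f.
Qed.

Lemma prod_fibers (R : comNzRingType) (H Y : finType) (f : H -> Y)
    (A : {set H}) (z : Y -> R) :
  \prod_(v in A) z (f v) = \prod_y z y ^+ #|[set v in A | f v == y]|.
Proof.
rewrite (partition_big f predT) //=; apply: eq_bigr => y _.
rewrite -prodr_const; apply: eq_big => v; first by rewrite inE.
by move=> /andP[_ /eqP ->].
Qed.

(** * Averages over independent signs *)

Definition sgb (R : nzRingType) (b : bool) : R := (-1) ^+ b.

Section Signs.
Context (R : numFieldType) (V : finType).
Local Notation sg := (@sgb R).

(** Flipping the sign at [v] is an involution on sign patterns that negates every summand. *)
Lemma sum_sign_odd (v : V) (F : {ffun V -> bool} -> R) :
  (forall s : {ffun V -> bool}, F [ffun w => if w == v then ~~ s w else s w] = F s) ->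
  \sum_(s : {ffun V -> bool}) sg (s v) * F s = 0.
Proof.
move=> Fflip; set S := LHS.
suff: S = - S by move/eqP; rewrite -addr_eq0 -mulr2n mulrn_eq0 => /eqP.
rewrite -sumrN /S.
pose fl (s : {ffun V -> bool}) := [ffun w => if w == v then ~~ s w else s w].
have flK : involutive fl.
  by move=> s; apply/ffunP => w; rewrite !ffunE; case: eqP => // _; rewrite negbK.
rewrite (reindex_inj (inv_inj flK)); apply: eq_bigr => s _.
by rewrite Fflip /fl ffunE eqxx /sgb signrN mulNr.
Qed.

Lemma sum_sign (v : V) : \sum_(s : {ffun V -> bool}) sg (s v) = 0.
Proof.
by rewrite -[RHS](@sum_sign_odd v (fun=> 1)) //; under [RHS]eq_bigr do rewrite mulr1.
Qed.

Lemma sum_sign2 (v w : V) :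
  \sum_(s : {ffun V -> bool}) sg (s v) * sg (s w) =
  (v == w)%:R * (2 ^ #|V|)%:R.
Proof.
case: eqP => [<-|/eqP vw]; last first.
  rewrite mul0r sum_sign_odd // => s.
  by rewrite ffunE eq_sym (negPf vw).
rewrite mul1r; under eq_bigr do rewrite /sgb -expr2 sqrr_sign.
by rewrite sumr_const card_ffun card_bool.
Qed.

End Signs.

(** * Polynomials that are negative near zero *)

Lemma horner_lt0_near0 (R : realType) (p : {poly R}) (d : R) :
  p.[0] < 0 -> 0 < d -> exists2 e, 0 < e < d & p.[e] < 0.
Proof.
move=> p0 d0.
have : root (p - p.[0]%:P) 0 by rewrite /root hornerD hornerN hornerC subrr.
case/factor_theorem => q; rewrite subr0 => /(congr1 (fun r => r + p.[0]%:P)).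
rewrite subrK => pE.
have [C qC] := poly_itv_bound q 0 1.
have C1 : 0 < `|C| + 1 by rewrite ltr_wpDl.
(* The three bounds give [e < d], keep [e] in [0, 1] where [C] bounds [q], and make [q.[e] * e] at
   most half of [- p.[0]]. *)
pose e := Num.min (d / 2) (Num.min 1 (- p.[0] / (`|C| + 1) / 2)).
have e0 : 0 < e.
  by rewrite !lt_min ltr01 !divr_gt0 ?oppr_gt0.
have ed : e <= d / 2 by rewrite ge_min lexx.
have e1 : e <= 1 by rewrite !ge_min lexx orbT.
have ep : e <= - p.[0] / (`|C| + 1) / 2 by rewrite !ge_min lexx !orbT.
exists e; first by rewrite e0 /=; lra.
have qe : q.[e] <= `|C| + 1.
  apply: (le_trans (ler_norm _)); apply: (@le_trans _ _ C).
    by rewrite qC // ltW.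
  by apply: (le_trans (ler_norm _)); rewrite lerDl.
rewrite pE hornerD hornerMX hornerC.
have : q.[e] * e <= - p.[0] / 2.
  apply: (@le_trans _ _ ((`|C| + 1) * e)); first by rewrite ler_pM2r.
  by rewrite mulrC -ler_pdivlMr // mulrAC.
lra.
Qed.

Lemma horner_order2_lt0 (R : realType) (p : {poly R}) (d : R) :
  p`_0 = 0 -> p`_1 = 0 -> p`_2 < 0 -> 0 < d ->
  exists2 e, 0 < e < d & p.[e] < 0.
Proof.
move=> p0 p1 p2 d0; pose q := \poly_(i < size p) p`_i.+2.
have pE : p = q * 'X^2.
  apply/polyP => -[|[|i]]; rewrite coefMXn //= subn2 /= coef_poly.
  by case: ltnP => // ip; rewrite nth_default // (leq_trans ip) // ltnW.
have [|e /andP[e0 ed] qe] := @horner_lt0_near0 R q d _ d0.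
  rewrite horner_coef0 coef_poly; case: ltnP => // s0; move: p2.
  by rewrite nth_default ?ltxx // (leq_trans s0).
exists e; rewrite ?e0 // pE hornerM hornerXn.
by rewrite pmulr_llt0 // exprn_gt0.
Qed.

(** * Second-order effect of random signs *)

Section SignedPerturbation.
Context (R : realType) (H : sgraph) (S : finType).
Context (root : pred S) (d : S -> R).
Local Notation sg := (@sgb R).

(** The first-order relative change of the edge between [p] and [q]: each end satisfying [root]
    contributes its sign times [d] of the other end. *)
Let L (p q : S * bool) : R :=
  (root p.1)%:R * sg p.2 * d q.1 + (root q.1)%:R * sg q.2 * d p.1.

Let c (h : {ffun H -> S}) (s : {ffun H -> bool}) (e : H * H) : R :=
  L (h e.1, s e.1) (h e.2, s e.2).

Lemma sum_signed_edges (h : {ffun H -> S}) (s : {ffun H -> bool}) :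
  \sum_(e in edges H) c h s e =
  \sum_v sg (s v) * ((root (h v))%:R * \sum_(v' | adj v v') d (h v')).
Proof.
pose F v v' := (root (h v))%:R * sg (s v) * d (h v').
rewrite (eq_bigr (fun e : H * H => F e.1 e.2 + F e.2 e.1)) //.
rewrite big_edges; apply: eq_bigr => v _.
by rewrite mulrA [sg _ * _]mulrC big_distrr.
Qed.

Lemma sum_signs_sum_sq (D : H -> R) :
  \sum_(s : {ffun H -> bool}) (\sum_v sg (s v) * D v) ^+ 2 =
  (2 ^ #|H|)%:R * \sum_v D v ^+ 2.
Proof.
under eq_bigr do rewrite expr2 big_distrlr /=.
rewrite exchange_big big_distrr /=; apply: eq_bigr => v _.
rewrite exchange_big (bigD1 v) //= [X in _ + X]big1 ?addr0.
  under eq_bigr do rewrite mulrACA.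
  by rewrite -big_distrl /= sum_sign2 eqxx mul1r -expr2.
move=> w wv; under eq_bigr do rewrite mulrACA.
by rewrite -big_distrl /= sum_sign2 eq_sym (negPf wv) !mul0r.
Qed.

(** The cross term of each square carries the signs of the two distinct ends of an edge, so it
    averages to zero. *)
Lemma sum_signs_sq_edges (h : {ffun H -> S}) :
  \sum_(s : {ffun H -> bool}) \sum_(e in edges H) c h s e ^+ 2 =
  (2 ^ #|H|)%:R *
    \sum_v (root (h v))%:R * \sum_(v' | adj v v') d (h v') ^+ 2.
Proof.
rewrite exchange_big /=.
pose F v v' := (2 ^ #|H|)%:R * ((root (h v))%:R * d (h v') ^+ 2).
rewrite (eq_bigr (fun e : H * H => F e.1 e.2 + F e.2 e.1)); last first.
  move=> -[v w] /=; rewrite inE /= => /andP[vw _].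
  have vNw : v != w by apply/eqP => E; rewrite E adj_irrefl in vw.
  rewrite (eq_bigr (fun s : {ffun H -> bool} =>
    sg (s v) * sg (s v) * ((root (h v))%:R * d (h w)) ^+ 2 +
    sg (s w) * sg (s w) * ((root (h w))%:R * d (h v)) ^+ 2 +
    sg (s v) * sg (s w) *
      (2 * ((root (h v))%:R * d (h w)) * ((root (h w))%:R * d (h v))))); last first.
    by move=> s _; rewrite /c /L /=; ring.
  rewrite !big_split /= -!big_distrl /= !sum_sign2 !eqxx (negPf vNw) !mul0r addr0.
  by rewrite !mul1r /F !exprMn -!natrX; do 2 case: (root _).
rewrite big_edges big_distrr /=; apply: eq_bigr => v _.
by rewrite -!big_distrr.
Qed.

Lemma sum_offdiag (v : H) (a : H -> R) :
  \sum_(v1 | adj v v1) \sum_(v2 | adj v v2 && (v2 != v1)) a v1 * a v2 =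
  (\sum_(v1 | adj v v1) a v1) ^+ 2 - \sum_(v1 | adj v v1) a v1 ^+ 2.
Proof.
rewrite expr2 big_distrlr /= -sumrB; apply: eq_bigr => v1 vv1.
by rewrite [in RHS](bigD1 v1) //= expr2 addrC addrK.
Qed.

(** For a fixed map [h], the change of the edge product caused by the perturbation, summed over all
    signs, as a polynomial in its size. *)
Let pert (h : {ffun H -> S}) : {poly R} :=
  \sum_(s : {ffun H -> bool}) (\prod_(e in edges H) (1 + (c h s e)%:P * 'X) - 1).

(** The linear term is a combination of single signs and sums to zero. At second order only pairs of
    edges carrying the same sign survive, that is, two edges at a common vertex mapped into
    [root]. *)
Let pert_coef h : [/\ (pert h)`_0 = 0, (pert h)`_1 = 0 &
  (pert h)`_2 *+ 2 = (2 ^ #|H|)%:R *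
    \sum_(v0 | root (h v0)) \sum_(v1 | adj v0 v1)
      \sum_(v2 | adj v0 v2 && (v2 != v1)) d (h v1) * d (h v2)].
Proof.
have coefs s := coef_prod_1DX (index_enum _) (fun e : H * H => e \in edges H) (c h s).
rewrite /pert !coef_sum; split.
- by apply: big1 => s _; have [p0 _ _] := coefs s; rewrite coefB p0 coef1 subrr.
- under eq_bigr => s _.
    have [_ p1 _] := coefs s.
    rewrite coefB p1 coef1 subr0 sum_signed_edges; over.
  rewrite exchange_big big1 // => v _.
  by rewrite -big_distrl /= sum_sign mul0r.
- rewrite -sumrMnl.
  under eq_bigr => s _.
    have [_ _ p2] := coefs s.
    rewrite coefB coef1 subr0 p2 sum_signed_edges; over.
  rewrite sumrB sum_signs_sum_sq sum_signs_sq_edges -mulrBr -sumrB.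
  congr (_ * _); rewrite [RHS]big_mkcond /=; apply: eq_bigr => v _.
  case: (root _); last by rewrite !mul0r expr0n subr0.
  by rewrite !mul1r sum_offdiag.
Qed.

Lemma signed_perturbation (s0 : S) (w : S -> R) (E : S -> S -> R) :
  (forall p, 0 < w p) -> (forall p q, 0 <= E p q) -> (forall p q, E p q = E q p) ->
  \sum_(h : {ffun H -> S}) (\prod_v w (h v)) *
      (\prod_(e in edges H) E (h e.1) (h e.2)) *
      (\sum_(v0 | root (h v0)) \sum_(v1 | adj v0 v1)
         \sum_(v2 | adj v0 v2 && (v2 != v1)) d (h v1) * d (h v2)) < 0 ->
  ~ step_sidorenko R H.
Proof.
move=> w0 E0 Esym neg sid.
pose A (h : {ffun H -> S}) :=
  (\prod_v w (h v)) * (\prod_(e in edges H) E (h e.1) (h e.2)).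
pose D := \sum_h A h *: pert h.
(* [C] bounds every [L p q], so a perturbation of size below [C^-1] leaves the kernel
   nonnegative. *)
pose C := 1 + \sum_p \sum_q `|L p q|.
have C0 : 0 < C.
  by rewrite ltr_wpDr // sumr_ge0 // => p _; exact: sumr_ge0.
have LC p q : `|L p q| <= C.
  have pq : `|L p q| <= \sum_q `|L p q| by rewrite (bigD1 q) //= lerDl sumr_ge0.
  apply: (le_trans pq); apply: (@le_trans _ _ (\sum_p \sum_q `|L p q|)).
    rewrite [leRHS](bigD1 p) //= lerDl sumr_ge0 // => r _; exact: sumr_ge0.
  by rewrite /C lerDr.
have [||||e /andP[e0 eC]] := @horner_order2_lt0 R D C^-1.
- by rewrite coef_sum big1 // => h _; rewrite coefZ; have [-> _ _] := pert_coef h; rewrite mulr0.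
- by rewrite coef_sum big1 // => h _; rewrite coefZ; have [_ -> _] := pert_coef h; rewrite mulr0.
- rewrite -(pmulrn_llt0 _ (ltn0Sn 1)) coef_sum -sumrMnl.
  rewrite (eq_bigr (fun h => (2 ^ #|H|)%:R * (A h *
      (\sum_(v0 | root (h v0)) \sum_(v1 | adj v0 v1)
         \sum_(v2 | adj v0 v2 && (v2 != v1)) d (h v1) * d (h v2))))); last first.
    by move=> h _; rewrite coefZ -mulrnAr; have [_ _ ->] := pert_coef h; rewrite mulrCA.
  by rewrite -big_distrr /= pmulr_rlt0 // ltr0n expn_gt0.
- by rewrite invr_gt0.
apply/negP; rewrite -leNgt /D horner_sum.
pose K (a b : S * bool) := E a.1 b.1 * (1 + e * L a b).
have K0 a b : 0 <= K a b.
  rewrite mulr_ge0 //; have : e * `|L a b| <= 1.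
    rewrite (le_trans (ler_wpM2l (ltW e0) (LC a b))) //.
    by rewrite -ler_pdivlMr // div1r ltW.
  have : - (e * L a b) <= e * `|L a b|.
    by rewrite -mulrN ler_pM2l // ler_normr lexx orbT.
  lra.
have Ksym a b : K a b = K b a.
  by rewrite /K Esym /L; congr (_ * (1 + e * _)); exact: addrC.
have fst_surj p : exists a : S * bool, a.1 = p by exists (p, true).
(* Each term of [L] is odd in one of the two signs, so merging the halves of every vertex gives back
   [E]. *)
have Kavg (a b : S * bool) :
    \sum_(a' | a'.1 == a.1) \sum_(b' | b'.1 == b.1) w a'.1 * w b'.1 * K a' b' =
    E a.1 b.1 * ((\sum_(a' : S * bool | a'.1 == a.1) w a'.1) *
                 \sum_(b' : S * bool | b'.1 == b.1) w b'.1).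
  have sumS (F : S * bool -> R) p :
      \sum_(a' | a'.1 == p) F a' = F (p, true) + F (p, false).
    rewrite (bigD1 (p, true)) //= (bigD1 (p, false)) /=; last by rewrite eqxx xpair_eqE andbF.
    rewrite big_pred0 ?addr0 //.
    by move=> [q []] /=; rewrite !xpair_eqE ?andbT ?andbF; case: eqP.
  rewrite !sumS /K /L /sgb /= expr0 expr1; ring.
have := step_sidorenko_weighted (pi := fst) (s0, true) sid (fun a => w0 a.1)
  fst_surj K0 Ksym Kavg.
rewrite !sum_ffun_pair -subr_ge0 -sumrB; congr (0 <= _).
apply: eq_bigr => h _; rewrite hornerZ horner_sum -sumrB big_distrr /=.
apply: eq_bigr => s _; rewrite hornerD hornerN hornerC horner_prod mulrBr mulr1.
congr (_ - _).
  rewrite /A -mulrA; congr (_ * _); first by apply: eq_bigr => v _; rewrite ffunE.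
  rewrite -big_split /=; apply: eq_bigr => f _.
  by rewrite !ffunE /K !hornerE [e * _]mulrC.
by congr (_ * _); apply: eq_bigr => v _; rewrite !ffunE.
Qed.

End SignedPerturbation.

(** * Twins *)

(** Absorbs the factors at two distinct vertices into the product over all vertices, so that a later
    sum over twins can factorise. *)
Lemma prod_pick2 (R : comNzRingType) (V : finType) (v1 v2 : V) (a b : V -> R) :
  v2 != v1 ->
  \prod_v (if (v == v1) || (v == v2) then a v * b v else b v) =
  a v1 * a v2 * \prod_v b v.
Proof.
move=> v21; rewrite (bigD1 v1) //= (bigD1 v2) //= !eqxx orbT.
rewrite [in RHS](bigD1 v1) //= [in RHS](bigD1 v2) //=.
rewrite (eq_bigr b); last by move=> v /andP[/negPf -> /negPf ->].
by ring.
Qed.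

Lemma sum_option (R : nmodType) (A : finType) (F : option A -> R) :
  \sum_t F t = F None + \sum_s F (Some s).
Proof.
rewrite (bigD1 None) //=; congr (_ + _).
rewrite (reindex_omap (@Some A) id) //=; last by case.
by apply: eq_bigl => s; rewrite eqxx.
Qed.

(** The exponent of [(s y).+1] is the size of the fibre over [y], and [q] extracts the monomial with
    exponent 1 on [U] and 0 elsewhere. Exponents below [#|H|.+2] include all fibre sizes, and also 1
    when [H] is empty. *)
Lemma bij_onto_extraction (R : realFieldType) (H Y : finType) (U : {set Y}) :
  exists q : {ffun Y -> 'I_#|H|.+2} -> R, forall (f : H -> Y) (A : {set H}),
    \sum_s q s * \prod_(v in A) (s (f v)).+1%:R = (bij_onto f A U)%:R.
Proof.
have [q qE] := @multi_coef_extraction R #|H|.+2 Y [ffun y => inord (y \in U)].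
exists q => f A.
have lt_card y : (#|[set v in A | f v == y]| < #|H|.+2)%N.
  by rewrite ltnS ltnW // ltnS max_card.
under eq_bigr => s _.
  rewrite (@prod_fibers R H Y f A (fun y => (s y).+1%:R)).
  rewrite (eq_bigr (fun y =>
    (s y).+1%:R ^+ (inord #|[set v in A | f v == y]| : 'I_#|H|.+2))); last first.
    by move=> y _; rewrite inordK.
  over.
rewrite qE -bij_onto_card; congr (_ %:R); congr nat_of_bool.
apply: eq_forallb => y; rewrite ffunE -(inj_eq val_inj) /= !inordK //.
by case: (y \in U).
Qed.

Section Twins.
Context (R : realType) (H : sgraph) (G : wgraph R) (k : nat).
Context (u0 : G) (u : 'I_k -> G) (U : 'I_k -> {set G}) (x : 'I_k -> R).

(** Extension by zero to non-edges lets sums run over all maps instead of homomorphisms. *)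
Let adjw (y y' : G) : R := (adj y y')%:R * eweight y y'.

Let local_weight (g : {ffun H -> G}) (v : H) : R :=
  \sum_i (g v == u i)%:R * x i * (bij_onto g (nbrs v) (U i))%:R.

Let prod_adjw (g : {ffun H -> G}) :
  \prod_(e in edges H) adjw (g e.1) (g e.2) =
  (is_hom g)%:R * \prod_(e in edges H) eweight (g e.1) (g e.2).
Proof.
rewrite big_split /=; congr (_ * _); case: (boolP (is_hom g)) => [homg|].
  apply: big1 => -[v v']; rewrite inE /= => /andP[vv' _].
  by move/forallP/(_ v)/forallP/(_ v')/implyP: homg => ->.
rewrite negb_forall => /existsP[v]; rewrite negb_forall => /existsP[v'].
rewrite negb_imply => /andP[vv' /negPf gvv'].
suff [e eH ge] : exists2 e, e \in edges H & adj (g e.1) (g e.2) = false.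
  by rewrite (bigD1 e) //= ge mul0r.
have [lt|lt|eqv] := ltngtP (enum_rank v) (enum_rank v').
- by exists (v, v'); rewrite // inE /= vv' lt.
- by exists (v', v); rewrite ?inE /= adj_sym ?vv' ?lt.
- by move: vv'; rewrite (enum_rank_inj (ord_inj eqv)) adj_irrefl.
Qed.

Let walk_form : R :=
  \sum_(v0 : H) \sum_(v1 | adj v0 v1) \sum_(v2 | adj v0 v2)
    \sum_(g : {ffun H -> G} | is_hom g && (g v0 == u0))
       hom_weight g * (local_weight g v1 * local_weight g v2).

Lemma walk_mx_form :
  \sum_i \sum_j x i * walk_mx H u0 u U i j * x j = walk_form.
Proof.
transitivity (\sum_i \sum_j \sum_(v0 : H) \sum_(v1 | adj v0 v1)
    \sum_(v2 | adj v0 v2) \sum_(g : {ffun H -> G} | is_hom g && (g v0 == u0))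
      hom_weight g *
      (((g v1 == u i)%:R * x i * (bij_onto g (nbrs v1) (U i))%:R) *
       ((g v2 == u j)%:R * x j * (bij_onto g (nbrs v2) (U j))%:R))).
  apply: eq_bigr => i _; apply: eq_bigr => j _.
  rewrite mxE big_distrr big_distrl; apply: eq_bigr => v0 _ /=.
  rewrite big_distrr big_distrl; apply: eq_bigr => v1 _ /=.
  rewrite big_distrr big_distrl; apply: eq_bigr => v2 _ /=.
  rewrite big_distrr big_distrl big_mkcond [RHS]big_mkcond; apply: eq_bigr => g _ /=.
  case: (is_hom g) (g v0 == u0) => [] [] //=.
  case: (g v1 == u i) => /=; last by rewrite !mul0r mulr0.
  case: (g v2 == u j) => /=; last by rewrite !mul0r !mulr0.
  case: (bij_onto g (nbrs v1) (U i)) => /=; last by rewrite !mulr0 mul0r mulr0.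
  case: (bij_onto g (nbrs v2) (U j)) => /=; last by rewrite !mulr0.
  ring.
under eq_bigr do rewrite exchange_big.
rewrite exchange_big; apply: eq_bigr => v0 _ /=.
under eq_bigr do rewrite exchange_big.
rewrite exchange_big; apply: eq_bigr => v1 _ /=.
under eq_bigr do rewrite exchange_big.
rewrite exchange_big; apply: eq_bigr => v2 _ /=.
under eq_bigr do rewrite exchange_big.
rewrite exchange_big; apply: eq_bigr => g _ /=.
under eq_bigr do rewrite -big_distrr.
by rewrite -big_distrr /= big_distrlr.
Qed.

Let offdiag_form : R :=
  \sum_(g : {ffun H -> G}) (\prod_(e in edges H) adjw (g e.1) (g e.2)) *
    \sum_(v0 | g v0 == u0) \sum_(v1 | adj v0 v1)
      \sum_(v2 | adj v0 v2 && (v2 != v1))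
        local_weight g v1 * local_weight g v2 * \prod_v vweight (g v).

(** The omitted terms [v1 = v2] are squares times nonnegative weights. *)
Lemma offdiag_form_le : offdiag_form <= walk_form.
Proof.
have -> : walk_form = \sum_(g : {ffun H -> G})
    (\prod_(e in edges H) adjw (g e.1) (g e.2)) *
    \sum_(v0 | g v0 == u0) \sum_(v1 | adj v0 v1) \sum_(v2 | adj v0 v2)
        local_weight g v1 * local_weight g v2 * \prod_v vweight (g v).
  rewrite /walk_form.
  under eq_bigr => v0 _.
    under eq_bigr => v1 _.
      rewrite exchange_big; over.
    rewrite exchange_big; over.
  rewrite (exchange_big_dep (@is_hom H G)) /=; last by move=> v0 g _ /andP[].
  rewrite big_mkcond; apply: eq_bigr => g _; rewrite prod_adjw.
  case: (is_hom g); last by rewrite !mul0r.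
  rewrite mul1r /= big_distrr; apply: eq_bigr => v0 _ /=.
  rewrite big_distrr; apply: eq_bigr => v1 _ /=.
  rewrite big_distrr; apply: eq_bigr => v2 _ /=.
  by rewrite /hom_weight; ring.
apply: ler_sum => g _; apply: ler_wpM2l.
  apply: prodr_ge0 => e _; rewrite /adjw; case: (boolP (adj _ _)) => a.
    by rewrite mul1r eweight_ge0.
  by rewrite mul0r.
apply: ler_sum => v0 _; apply: ler_sum => v1 vv1.
rewrite [leRHS](bigD1 v1) //= lerDr mulr_ge0 //.
  by rewrite -expr2 sqr_ge0.
by apply: prodr_ge0 => v _; exact: vweight_ge0.
Qed.

Local Notation twin := (option {ffun G -> 'I_#|H|.+2}).

(** [None] is the original vertex and [Some s] its twin with scaling [s]. *)
Let scale (t : twin) (y : G) : R := if t is Some s then (s y).+1%:R else 1.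

Let scale_sum (g : {ffun H -> G}) (v : H) : R :=
  \sum_(t : twin) \prod_(v' in nbrs v) scale t (g v').

(** The second-order sum after summing over all twins, as a polynomial in their weight eta. At [v1]
    and [v2] eta cancels; elsewhere it multiplies [scale_sum], which includes the original. *)
Let offdiag_poly : {poly R} :=
  \sum_(g : {ffun H -> G}) (\prod_(e in edges H) adjw (g e.1) (g e.2))%:P *
    \sum_(v0 | g v0 == u0) \sum_(v1 | adj v0 v1)
      \sum_(v2 | adj v0 v2 && (v2 != v1))
        \prod_v (if (v == v1) || (v == v2) then
                   (local_weight g v * vweight (g v))%:P
                 else (vweight (g v))%:P + (scale_sum g v)%:P * 'X).

Let offdiag_poly0 : offdiag_poly.[0] = offdiag_form.
Proof.
rewrite /offdiag_poly horner_sum; apply: eq_bigr => g _.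
rewrite hornerM hornerC horner_sum; congr (_ * _); apply: eq_bigr => v0 _.
rewrite horner_sum; apply: eq_bigr => v1 _.
rewrite horner_sum; apply: eq_bigr => v2 /andP[_ v21].
rewrite horner_prod -(prod_pick2 (local_weight g)) //.
apply: eq_bigr => v _; case: ifP => _; first by rewrite hornerC.
by rewrite !hornerE.
Qed.

Lemma walk_mx_not_step_sidorenko :
  \sum_i \sum_j x i * walk_mx H u0 u U i j * x j < 0 -> ~ step_sidorenko R H.
Proof.
rewrite walk_mx_form => /(le_lt_trans offdiag_form_le).
rewrite -offdiag_poly0 => /horner_lt0_near0 /(_ ltr01)[eta /andP[eta0 _]].
have [q qE] := choice (fun i => @bij_onto_extraction R H G (U i)).
(* Adding eta to the weight of the originals as well makes all weights positive,
   since the parts of a partition of [0, 1] have positive measure. *)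
pose w (p : G * twin) := (if p.2 is None then vweight p.1 else 0) + eta.
(* Dividing by [eta] cancels the weight of a twin; originals are not perturbed. *)
pose d (p : G * twin) := if p.2 is Some s then
  (\sum_i (p.1 == u i)%:R * x i * q i s) * vweight p.1 / eta else 0.
pose E (p p' : G * twin) := adjw p.1 p'.1 * (scale p.2 p'.1 * scale p'.2 p.1).
have scale_ge0 t y : 0 <= scale t y by case: t => [s|]; rewrite /= ?ler0n ?ler01.
have adjwC y y' : adjw y y' = adjw y' y.
  rewrite /adjw [adj y' y]adj_sym; case: (boolP (adj y y')) => [a|_].
    by rewrite (eweight_sym a).
  by rewrite !mul0r.
move=> neg; apply: (@signed_perturbation R H _ (fun p => p.1 == u0) d (u0, None) w E).
- by move=> [y [s|]]; rewrite /w /= ?add0r // ltr_wpDl // vweight_ge0.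
- move=> p p'; rewrite /E; apply: mulr_ge0; last exact: mulr_ge0.
  rewrite /adjw; case: (boolP (adj p.1 p'.1)) => a; last by rewrite mul0r.
  by rewrite mul1r eweight_ge0.
- by move=> p p'; rewrite /E adjwC; congr (_ * _); exact: mulrC.
apply: le_lt_trans neg; rewrite le_eqVlt; apply/orP; left; apply/eqP.
rewrite sum_ffun_pair /offdiag_poly horner_sum; apply: eq_bigr => g _.
rewrite hornerM hornerC horner_sum big_distrr /=.
(* Once each scaling is assigned to the vertex whose twin causes it, the factor at [v] depends on
   [t] only through [t v]; the sum over [t] thus becomes a product of sums. *)
pose fac (v1 v2 v : H) (t : twin) := if (v == v1) || (v == v2) then
  d (g v, t) * (w (g v, t) * \prod_(v' in nbrs v) scale t (g v')) else
  w (g v, t) * \prod_(v' in nbrs v) scale t (g v').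
transitivity (\sum_(t : {ffun H -> twin}) \sum_(v0 | g v0 == u0)
    \sum_(v1 | adj v0 v1) \sum_(v2 | adj v0 v2 && (v2 != v1))
      (\prod_(e in edges H) adjw (g e.1) (g e.2)) * \prod_v fac v1 v2 v (t v)).
  apply: eq_bigr => t _.
  have -> : \prod_(e in edges H)
       E ([ffun v => (g v, t v)] e.1) ([ffun v => (g v, t v)] e.2) =
      (\prod_(e in edges H) adjw (g e.1) (g e.2)) *
      \prod_v \prod_(v' in nbrs v) scale (t v) (g v').
    under eq_bigr do rewrite !ffunE /E /=.
    rewrite big_split /=; congr (_ * _).
    rewrite (big_edges _ (fun v v' => scale (t v) (g v'))).
    by apply: eq_bigr => v _; apply: eq_bigl => v'; rewrite inE.
  rewrite big_distrr /=; apply: eq_big => [v0|v0 _]; first by rewrite ffunE.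
  rewrite big_distrr /=; apply: eq_bigr => v1 _.
  rewrite big_distrr /=; apply: eq_bigr => v2 /andP[_ v21].
  rewrite (prod_pick2 (fun v => d (g v, t v))) // !ffunE [X in _ = _ * (_ * X)]big_split /=.
  rewrite (eq_bigr (fun v => w (g v, t v))); last by move=> v _; rewrite ffunE.
  ring.
rewrite exchange_big /=; apply: eq_bigr => v0 _.
rewrite horner_sum big_distrr exchange_big /=; apply: eq_bigr => v1 _.
rewrite horner_sum big_distrr exchange_big /=; apply: eq_bigr => v2 _.
rewrite -big_distrr /=; congr (_ * _).
rewrite horner_prod -(bigA_distr_bigA (fac v1 v2)) /=; apply: eq_bigr => v _.
rewrite /fac; case: ifP => _; last first.
  rewrite !hornerE /scale_sum big_distrl !sum_option /= big1_eq.
  rewrite /w /= mulr1 mul1r -addrA; congr (_ + (_ + _)).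
  by apply: eq_bigr => s _; rewrite add0r mulrC.
rewrite hornerC sum_option /= mul0r add0r /local_weight big_distrl /=.
(* With eta cancelled, the sum over [s] is the extraction that yields the bijectivity indicator. *)
transitivity (\sum_s \sum_i (g v == u i)%:R * x i * vweight (g v) *
    (q i s * \prod_(v' in nbrs v) (s (g v')).+1%:R)).
  apply: eq_bigr => s _; rewrite /d /w /= add0r !big_distrl /=.
  apply: eq_bigr => i _; field.
  by rewrite gt_eqF.
rewrite exchange_big; apply: eq_bigr => i _.
by rewrite -big_distrr /= qE mulrAC.
Qed.

End Twins.

(** * Symmetry of the matrix and conclusion *)

Lemma walk_mx_sym (R : realType) (H : sgraph) (G : wgraph R) (k : nat)
    (u0 : G) (u : 'I_k -> G) (U : 'I_k -> {set G}) :
  (walk_mx H u0 u U)^T = walk_mx H u0 u U.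
Proof.
apply/matrixP => i j; rewrite !mxE; apply: eq_bigr => v0 _.
rewrite exchange_big; apply: eq_bigr => v1 _; apply: eq_bigr => v2 _.
apply: eq_bigl => f; congr (_ && (_ && _)).
by case: (_ == u i); case: (_ == u j) => //=; exact: andbC.
Qed.

Theorem theorem3 (R : realType) (H : sgraph) (G : wgraph R) (k : nat)
  (u0 : G) (u : 'I_k -> G) (U : 'I_k -> {set G})
  (u_inj : injective u)
  (u0u : forall i, adj u0 (u i))
  (u_indep : forall i j, ~~ adj (u i) (u j))
  (U_nbrs : forall i, U i \subset nbrs (u i))
  (u0_U : forall i, u0 \in U i)
  (M_npsd : ~ psdmx (walk_mx H u0 u U)) :
  ~ step_sidorenko R H.
Proof.
(* The matrix is symmetric by exchanging [v1] and [v2], so only a vector with a negative value of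
   the quadratic form has to be excluded. *)
move=> sid; apply: M_npsd; split; first exact: walk_mx_sym.
move=> x; rewrite leNgt; apply/negP => neg.
apply: (@walk_mx_not_step_sidorenko R H G k u0 u U (fun i => x i 0) _ sid).
apply: le_lt_trans neg; rewrite le_eqVlt; apply/orP; left; apply/eqP.
rewrite exchange_big [RHS]mxE; apply: eq_bigr => j _.
rewrite [X in _ = X * _]mxE big_distrl; apply: eq_bigr => i _.
by rewrite [x^T _ _]mxE.
Qed.
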